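(* Let $w$ be a strictly positive density on $U$. If $\frac{w_i w_i^c}{w}\in\mathcal L^\infty$ for all $1\le i\le n$, then $w$ satisfies the Smirnov property, for every exponent $q>1$.
   Context: Let $n\ge 2$ and $U=I_1\times\dots\times I_n\subset\mathbb R^n$, where each $I_i$ is a closed interval of the form $(-\infty,b]$, $[a,\infty)$ or $[a,b]$ with $a<b$. A strictly positive density on $U$ is a Lebesgue-measurable $w:U\to(0,\infty)$ with $\int_U w(\xi)\,d\xi=1$. For $r\ge1$, $\mathcal L^r(w)$ is the space of (a.e.-equivalence classes of) Lebesgue-measurable $f:U\to\mathbb R$ with $\int_U|f(\xi)|^r w(\xi)\,d\xi<\infty$; $\mathcal L^\infty$ is the space of essentially bounded functions on $U$. A function of the single coordinate $\xi_i$ is regarded as a function on $U$. For $\xi=(\xi_1,\dots,\xi_n)$, $\xi_i^c$ denotes the $(n-1)$-vector obtained by omitting $\xi_i$. The marginal densities are $w_i(\xi_i)=\int w(\xi)\,d\xi_i^c$ and $w_i^c(\xi_i^c)=\int w(\xi)\,d\xi_i$. Smirnov property with exponent $q>1$: whenever $f(\xi)=\frac1n\sum_{i=1}^n\Psi_i(\xi_i)\in\mathcal L^q(w)$ with each $\Psi_i$ depending only on $\xi_i$ and $\Psi_i\in\mathcal L^1(w)$ for $1\le i\le n$, then $\Psi_i\in\mathcal L^q(w)$ for all $1\le i\le n$. *)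

(* Defs.v *)
From HB Require Import structures.
From mathcomp Require Import all_boot all_order all_algebra.
From mathcomp Require Import all_classical all_reals all_analysis.
From mathcomp Require Import measurable_realfun ess_sup_inf.

Set Implicit Arguments.
Unset Strict Implicit.
Unset Printing Implicit Defensive.

Import Order.TTheory GRing.Theory Num.Theory.
Import numFieldNormedType.Exports.

Local Open Scope classical_set_scope.
Local Open Scope ring_scope.

Section product_lebesgue_step.
Context (R : realType) (n : nat).
Variable m : {sigma_finite_measure set (n.-tuple (measurableTypeR R)) -> \bar R}.

Definition tuple_cons (p : measurableTypeR R * n.-tuple (measurableTypeR R)) :
  n.+1.-tuple (measurableTypeR R) := [tuple of p.1 :: p.2].

Lemma measurable_tuple_cons : measurable_fun [set: _] tuple_cons.
Proof.
exact: (measurable_cons (f := fst) (g := snd) measurable_fst measurable_snd).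
Qed.

Definition lebesgue_cons : set (n.+1.-tuple (measurableTypeR R)) -> \bar R :=
  pushforward (lebesgue_measure \x m)%E tuple_cons.

Let lebesgue_cons0 : lebesgue_cons set0 = 0%E.
Proof. by rewrite /lebesgue_cons /pushforward preimage_set0 measure0. Qed.

Let lebesgue_cons_ge0 A : (0 <= lebesgue_cons A)%E.
Proof. by rewrite /lebesgue_cons /pushforward; exact: measure_ge0. Qed.

Let lebesgue_cons_sigma_additive : semi_sigma_additive lebesgue_cons.
Proof.
move=> F mF tF mUF; rewrite /lebesgue_cons /pushforward preimage_bigcup.
apply: measure_semi_sigma_additive.
- by move=> k; rewrite -[X in measurable X]setTI; exact: measurable_tuple_cons.
- apply/trivIsetP => /= i j _ _ ij; rewrite -preimage_setI.
  by move/trivIsetP : tF => /(_ _ _ _ _ ij) ->//; rewrite preimage_set0.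
- rewrite -preimage_bigcup -[X in measurable X]setTI.
  exact: measurable_tuple_cons.
Qed.

HB.instance Definition _ := isMeasure.Build _ _ _ lebesgue_cons
  lebesgue_cons0 lebesgue_cons_ge0 lebesgue_cons_sigma_additive.

Let lebesgue_cons_sigma_finite : sigma_finite setT lebesgue_cons.
Proof.
have /sigma_finiteP[F [TF ndF Foo]] := sigma_finiteT (@lebesgue_measure R).
have /sigma_finiteP[G [TG ndG Goo]] := sigma_finiteT m.
pose g (t : n.+1.-tuple (measurableTypeR R)) :
  measurableTypeR R * n.-tuple (measurableTypeR R) :=
  (thead t, [tuple of behead t]).
have gK p : g (tuple_cons p) = p.
  case: p => x y; rewrite /g /tuple_cons /=; congr pair; exact: val_inj.
have mg : measurable_fun setT g.
  by apply/measurable_fun_pair; [exact: measurable_tnth|exact: measurable_behead].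
have TFG : \bigcup_k (F k `*` G k) = setT.
  rewrite -subTset => -[x y] _.
  have [k _ Fkx] : (\bigcup_k F k) x by rewrite -TF.
  have [l _ Gly] : (\bigcup_k G k) y by rewrite -TG.
  exists (maxn k l) => //; split => /=.
  - by move: x Fkx; apply/subsetPset/ndF; exact: leq_maxl.
  - by move: y Gly; apply/subsetPset/ndG; exact: leq_maxr.
exists (fun k => g @^-1` (F k `*` G k)).
  by rewrite -preimage_bigcup TFG preimage_setT.
move=> k; have [mF Fk] := Foo k; have [mG Gk] := Goo k; split.
  by rewrite -[X in measurable X]setTI; apply: mg => //; exact: measurableX.
rewrite /lebesgue_cons /pushforward (_ : _ @^-1` _ = F k `*` G k).
  by rewrite product_measure1E// lte_mul_pinfty// ge0_fin_numE.
by rewrite -comp_preimage (_ : g \o tuple_cons = id) ?preimage_id//; exact: funext.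
Qed.

HB.instance Definition _ := Measure_isSigmaFinite.Build _ _ _ lebesgue_cons
  lebesgue_cons_sigma_finite.

End product_lebesgue_step.

(* The n-fold product of [lebesgue_measure], on the Borel sets of R^n. *)
Fixpoint borel_lebesgue (R : realType) (n : nat) :
    {sigma_finite_measure set (n.-tuple (measurableTypeR R)) -> \bar R} :=
  match n with
  | 0%N => \d_ [tuple]
  | k.+1 => lebesgue_cons (borel_lebesgue R k)
  end.

(* R^n with its Lebesgue-measurable sets, i.e. the Caratheodory completion of
   the Borel sets with respect to [borel_lebesgue]. *)
Definition Rn (R : realType) (n : nat) : measurableType _ :=
  caratheodory_type ((borel_lebesgue R n)^*)%mu.

Definition lebesgue_tuple (R : realType) (n : nat) : set (Rn R n) -> \bar R :=
  @completed_measure_extension _ _ _ (borel_lebesgue R n).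
HB.instance Definition _ (R : realType) (n : nat) :=
  Measure.on (@lebesgue_tuple R n).

Section densities.
Context {R : realType} {n : nat}.
Implicit Types (J : interval R) (I : 'I_n -> interval R) (w f : Rn R n -> R).

(* The real line is not among the allowed intervals. *)
Definition is_closed_side J : Prop :=
  [\/ exists b, J = `]-oo, b],
      exists a, J = `[a, +oo[ |
      exists a b, a < b /\ J = `[a, b]].

Definition box I : set (Rn R n) :=
  [set xi | forall i, tnth xi i \in I i].

(* The box with its [i]-th side removed; [lift i] enumerates the indices
   different from [i]. *)
Definition box_omit I (i : 'I_n) : set (Rn R n.-1) :=
  [set eta | forall k, tnth eta k \in I (lift i k)].

Definition omit_coord (i : 'I_n) (xi : Rn R n) : Rn R n.-1 :=
  [tuple tnth xi (lift i k) | k < n.-1].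

(* The [xi] with [tnth xi i = x] and [omit_coord i xi = eta]. *)
Definition insert_coord (i : 'I_n) (x : R) (eta : Rn R n.-1) : Rn R n :=
  [tuple if unlift i j is Some k then tnth eta k else x | j < n].

Definition strictly_positive_density I w : Prop :=
  [/\ measurable_fun (box I) w,
      forall xi, box I xi -> 0 < w xi &
      (\int[@lebesgue_tuple R n]_(xi in box I) (w xi)%:E = 1)%E].

(* The marginals are extended-real valued: the integrals may be infinite for
   a null set of arguments. *)
Definition marginal I w (i : 'I_n) (x : R) : \bar R :=
  (\int[@lebesgue_tuple R n.-1]_(eta in box_omit I i)
    (w (insert_coord i x eta))%:E)%E.

Definition comarginal I w (i : 'I_n) (eta : Rn R n.-1) : \bar R :=
  (\int[@completed_lebesgue_measure R]_(x in [set` I i])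
    (w (insert_coord i x eta))%:E)%E.

Definition in_Lr I w (r : R) f : Prop :=
  measurable_fun (box I) f /\
  (\int[@lebesgue_tuple R n]_(xi in box I) (`|f xi| `^ r * w xi)%:E < +oo)%E.

Definition in_Loo I (g : Rn R n -> \bar R) : Prop :=
  measurable_fun (box I) g /\
  (ess_sup (@lebesgue_tuple R n) (abse \o (g \_ (box I))) < +oo)%E.

(* Elements of L^r are a.e. classes, so [f] is only required to agree almost
   everywhere with the average of the [Psi i]. *)
Definition smirnov_property I w (q : R) : Prop :=
  forall (f : Rn R n -> R) (Psi : 'I_n -> R -> R),
    ae_eq (@lebesgue_tuple R n) (box I) f
      (fun xi => n%:R^-1 * \sum_(i < n) Psi i (tnth xi i)) ->
    in_Lr I w q f ->
    (forall i, in_Lr I w 1 (fun xi => Psi i (tnth xi i))) ->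
    forall i, in_Lr I w q (fun xi => Psi i (tnth xi i)).

End densities.

(* Main.v *)
(* Boundedness of [w_i w_i^c / w] makes [n f = Psi_i + g], with [g] a function
   of [xi_i^c], an L^q function for the product density [w_i w_i^c]. By Tonelli
   almost every section [Psi_i + c], with [c] a constant, is then in L^q(w_i).
   One such section suffices: [w_i] is integrable, so [Psi_i] is in L^q(w_i),
   hence in L^q(w). As Tonelli's theorem is available for Borel functions only,
   one Borel null set [N] is discarded, off which [w] and [f] are Borel and the
   a.e. hypotheses hold. *)

Require Import Defs.
From mathcomp Require Import all_boot all_order all_algebra.
From mathcomp Require Import all_classical all_reals all_analysis.
From mathcomp Require Import measurable_realfun ess_sup_inf.


Set Implicit Arguments.
Unset Strict Implicit.
Unset Printing Implicit Defensive.

Import Order.TTheory GRing.Theory Num.Theory.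
Import numFieldNormedType.Exports.

Local Open Scope classical_set_scope.
Local Open Scope ring_scope.

(** Since |a| <= 2 max(|a + c|, |c|), and the [q]-th power of a maximum is at most the sum of the
    [q]-th powers. It recovers the integrability of Psi_i from that of Psi_i + c. *)
Lemma powR_normD_le (R : realType) (q a c : R) : (0 <= q)%R ->
  (`|a| `^ q <= 2 `^ q * (`|a + c| `^ q + `|c| `^ q))%R.
Proof.
move=> q0.
have ac : (`|a| <= 2 * Num.max `|a + c| `|c|)%R.
  have := ler_normB (a + c) c; rewrite addrK => /le_trans; apply.
  by rewrite mulr_natl mulr2n lerD// le_max lexx ?orbT.
apply: (@le_trans _ _ ((2 * Num.max `|a + c| `|c|) `^ q)%R).
  by apply: ge0_ler_powR => //; rewrite nnegrE// mulr_ge0// le_max normr_ge0.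
rewrite powRM ?le_max ?normr_ge0// ler_wpM2l ?powR_ge0//.
by case: (leP `|a + c| `|c|) => _; rewrite ?lerDl ?lerDr ?powR_ge0.
Qed.

Local Open Scope ereal_scope.

(** * Sets and functions measurable for the completion, up to null sets *)

Section completion.
Context d (T : measurableType d) (R : realType).
Variable mu : {sigma_finite_measure set T -> \bar R}.
Local Notation "mu^*" := (mu_ext mu).

Let mu_extE (B : set T) : measurable B -> mu^* B = mu B.
Proof. exact: measurable_mu_extE. Qed.

Lemma mu_ext_measurable_cover (X : set T) : mu^* X < +oo ->
  exists B, [/\ measurable B, X `<=` B & mu B = mu^* X].
Proof.
move=> Xoo.
have Xfin : mu^* X \is a fin_num by rewrite ge0_fin_numE// mu_ext_ge0.
have cov (k : nat) : exists F, [/\ measurable F, X `<=` F &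
    mu F <= mu^* X + k.+1%:R^-1%:E].
  have k0 : (0 < k.+1%:R^-1 :> R)%R by rewrite invr_gt0.
  have [_ [A [mA XA] <-] /ltW AX] := lb_ereal_inf_adherent k0 Xfin.
  have mUA : measurable (\bigcup_i A i) by exact: bigcupT_measurable.
  exists (\bigcup_i A i); split => //.
  by apply: le_trans AX; exact: measure_sigma_subadditive.
have /choice[F mF] := cov.
have mB : measurable (\bigcap_k F k).
  by apply: bigcapT_measurable => k; case: (mF k).
have XB : X `<=` \bigcap_k F k.
  by move=> x Xx k _; case: (mF k) => _ /(_ _ Xx).
exists (\bigcap_k F k); split => //.
apply/eqP; rewrite eq_le; apply/andP; split; last first.
  by rewrite -(mu_extE mB); exact: le_mu_ext.
apply/lee_addgt0Pr => _/posnumP[e]; near \oo => k.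
have [mFk _ Fk] := mF k.
apply: (@le_trans _ _ (mu (F k))).
  by apply: le_measure; rewrite ?inE//; exact: bigcap_inf.
apply: (le_trans Fk); rewrite leeD2l// lee_fin ltW//.
by near: k; apply: near_infty_natSinv_lt.
Unshelve. all: by end_near. Qed.

(** Cut the space into pieces [S i] of finite measure and cover [S i] minus [A] by a measurable
    [D i]. Then [S i] minus [D i] is a measurable subset of [A], and the rest of [A] in [S i] lies
    in [D i], where [A] is null. *)
Lemma caratheodory_setD_null (A : set T) : mu^*.-cara.-measurable A ->
  exists N, [/\ measurable N, mu N = 0 & measurable (A `\` N)].
Proof.
move=> mA.
have [S TS mS] := sigma_finiteT mu.
(* If [D] is a measurable cover of [S i `\` A] with the same outer measure, then
   [A `&` D] is null because [A] splits [D] additively. *)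
have H i : exists D N, [/\ measurable D, S i `\` A `<=` D,
  measurable N, A `&` D `<=` N & mu N = 0].
  have [mSi Sioo] := mS i.
  have SAoo : mu^* (S i `\` A) < +oo.
    apply: (@le_lt_trans _ _ (mu (S i))) => //.
    by rewrite -mu_extE//; exact: le_mu_ext.
  have [D [mD SAD muD]] := mu_ext_measurable_cover SAoo.
  have AD0 : mu^* (A `&` D) = 0.
    have := mA D; rewrite /= mu_extE// muD => DA.
    have : mu^* (D `&` A) + mu^* (D `&` ~` A) <= 0 + mu^* (D `&` ~` A).
      rewrite -DA add0e; apply: le_mu_ext => x [Sx nAx]; split => //.
      exact: SAD.
    rewrite leeD2rE.
      by rewrite setIC => ?; apply/eqP; rewrite eq_le mu_ext_ge0 ?andbT.
    rewrite ge0_fin_numE ?mu_ext_ge0//.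
    by rewrite (le_lt_trans _ SAoo)// DA leeDr// mu_ext_ge0.
  have [|N [mN ADN muN]] := @mu_ext_measurable_cover (A `&` D).
    by rewrite AD0.
  by exists D, N; split => //; rewrite muN.
have /choice[D /choice[N DN]] := H.
exists (\bigcup_i N i); split.
- by apply: bigcupT_measurable => i; case: (DN i).
- apply: measure_negligible.
    by apply: bigcupT_measurable => i; case: (DN i).
  by apply: negligible_bigcup => i; apply/negligibleP; case: (DN i).
- rewrite (_ : _ `\` _ = (\bigcup_i (S i `\` D i)) `\` \bigcup_i N i).
    apply: measurableD; apply: bigcupT_measurable => i; last by case: (DN i).
    by apply: measurableD; [case: (mS i)|case: (DN i)].
  apply/seteqP; split => x [Hx nNx]; split => //.
    have [i _ Six] : (\bigcup_i S i) x by rewrite -TS.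
    exists i => //; split => // Dx; apply: nNx; exists i => //.
    by case: (DN i) => _ _ _ + _; apply.
  case: Hx => i _ [Six nDx]; apply: contrapT => nAx; apply: nDx.
  by case: (DN i) => _ + _ _ _; apply.
Qed.

(** Measurability of [f] is decided by the countably many sets {f > q}, [q] rational, so the union
    of their exceptional null sets is still null. *)
Lemma caratheodory_measurable_fun_null (f : T -> R) :
  measurable_fun [set: caratheodory_type mu^*]
    (f : caratheodory_type mu^* -> R) ->
  exists N, [/\ measurable N, mu N = 0 & measurable_fun (~` N) f].
Proof.
move=> mf.
have H (q : rat) : exists N, [/\ measurable N, mu N = 0 &
    measurable (f @^-1` `]ratr q, +oo[ `\` N)].
  apply: caratheodory_setD_null.
  by rewrite -[X in measurable X]setTI; apply: mf.
have /choice[N mN] := H.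
have mUN : measurable (\bigcup_q N q).
  by apply: bigcupT_measurable_rat => q; case: (mN q).
exists (\bigcup_q N q); split => //.
- have : mu.-negligible (\bigcup_(q in [set: rat]) N q).
    (* Enumerates the rationals, as [negligible_bigcup] takes a sequence; the default 0 only repeats
       the set [N 0]. *)
    pose g (k : nat) : rat := odflt 0%R (unpickle k).
    have -> : \bigcup_(q in [set: rat]) N q = \bigcup_k N (g k).
      apply/seteqP; split => [x [q _ Nqx]|x [k _ Ngx]]; last by exists (g k).
      by exists (pickle q) => //; rewrite /g pickleK.
    by apply: negligible_bigcup => k; apply/negligibleP; case: (mN (g k)).
  by move/negligibleP; apply.
- move=> mD B mB; apply: (measurability _ (RGenOInfty.measurableE R)) => //.
  move=> _ [_ [x ->] <-].
  (* {f > x} is the union of {f > q} over the rationals q > x; the [if] inserts the empty set for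
     the other [q]. *)
  rewrite (_ : _ `&` _ = \bigcup_(q : rat)
     ((if (x < ratr q)%R then f @^-1` `]ratr q, +oo[ `\` N q else set0) `\`
      \bigcup_q N q)).
    apply: bigcupT_measurable_rat => q; apply: measurableD => //.
    by case: ifPn => // _; case: (mN q).
  apply/seteqP; split => [t [nNt]|t [q _ []]].
    rewrite /= in_itv/= andbT => /rat_in_itvoo[q].
    rewrite in_itv/= => /andP[xq qf].
    exists q => //; split => //; rewrite xq.
    split; first by rewrite /= in_itv/= qf.
    by move=> Nqt; apply: nNt; exists q.
  case: ifPn => // xq [/= + _] nNt; rewrite in_itv/= andbT => qf; split => //.
  by rewrite /= in_itv/= andbT (lt_trans xq).
Qed.
End completion.

(* This applies to [g] a section of [w], which may fail to be measurable. *)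
Lemma le_ge0_integral d (T : measurableType d) (R : realType)
    (mu : {measure set T -> \bar R}) (D E : set T) (f g : T -> \bar R) :
  D `<=` E -> (forall x, E x -> 0 <= g x) ->
  (forall x, D x -> 0 <= f x <= g x) ->
  \int[mu]_(x in D) f x <= \int[mu]_(x in E) g x.
Proof.
move=> DE g0 fg; rewrite !ge0_integralE//; last by move=> x /fg /andP[].
(* Each integral is by definition a supremum over simple functions below the integrand, and a simple
   function below [f] on [D] is below [g] on [E]. No measurability enters. *)
apply: ereal_sup_le => _ [h hf <-]; exists h => // x.
apply: (le_trans (hf x)); rewrite !patchE.
case: ifPn => xD; case: ifPn => xE //.
- by case/andP: (fg x (set_mem xD)).
- by move/negP: xE; rewrite inE; case; apply: DE; exact: set_mem.
- exact: g0 (set_mem _).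
Qed.

(** Change of variables, with [m2] the image of [m1]. Besides [tuple_cons], it serves for the
    identity from a completion to the Borel sets. *)
Lemma ge0_integral_preserving d1 d2
    (X : measurableType d1) (Y : measurableType d2)
    (R : realType) (phi : X -> Y) (m1 : {measure set X -> \bar R})
    (m2 : {measure set Y -> \bar R}) (f : Y -> \bar R) :
  measurable_fun setT phi ->
  (forall A, measurable A -> m1 (phi @^-1` A) = m2 A) ->
  measurable_fun setT f -> (forall y, 0 <= f y) ->
  \int[m2]_y f y = \int[m1]_x f (phi x).
Proof.
move=> mphi m12 mf f0.
rewrite -(ge0_integral_pushforward mphi m1 (D := setT))//.
by apply: eq_measure_integral => // A mA _; exact/esym/m12.
Qed.

(** * Tonelli's theorem on R^n with one coordinate singled out *)

Section tuples.
Variable R : realType.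
Local Notation BR := (measurableTypeR R).
Local Notation BT n := (n.-tuple (measurableTypeR R)).

Lemma insert_coord0 k (x : R) (eta : BT k) :
  insert_coord ord0 x eta = [tuple of x :: eta] :> BT k.+1.
Proof.
apply: eq_from_tnth => j; rewrite tnth_mktuple.
by case: unliftP => [l ->|->]; rewrite ?tnthS ?tnth0.
Qed.

(** Lets an induction on the dimension pass below the first coordinate. *)
Lemma insert_coordS k (i : 'I_k.+1) (x y : R) (eta : BT k) :
  insert_coord (lift ord0 i) x [tuple of y :: eta] =
  [tuple of y :: insert_coord i x eta] :> BT k.+2.
Proof.
apply: eq_from_tnth => j; rewrite tnth_mktuple.
case: unliftP => [m ->|->]; last by rewrite tnthS tnth_mktuple unlift_none.
case: (unliftP ord0 m) => [p ->|->].
  rewrite (_ : lift _ _ = lift ord0 (lift i p)).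
    by rewrite !tnthS tnth_mktuple liftK.
  by apply: val_inj; rewrite /= /bump /= !add1n ltnS; case: (i <= p)%N.
by rewrite (_ : lift _ _ = ord0) ?tnth0//; exact: val_inj.
Qed.

Lemma measurable_insert_coord k (i : 'I_k.+1) :
  measurable_fun [set: BR * BT k]
    (fun p => insert_coord i p.1 p.2 : BT k.+1).
Proof.
apply/measurable_fun_tnthP => j.
rewrite (_ : _ \o _ =
    fun p => if unlift i j is Some l then tnth p.2 l else p.1); last first.
  by apply/funext => p; rewrite /= tnth_mktuple.
case: unliftP => [l _|_].
  apply: (measurableT_comp (measurable_tnth l)); exact: measurable_snd.
exact: measurable_fst.
Qed.

Lemma measurable_insert_coordl k (i : 'I_k.+1) (x : BR) :
  measurable_fun [set: BT k] (fun eta => insert_coord i x eta : BT k.+1).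
Proof.
exact: (measurableT_comp (measurable_insert_coord i) (pair1_measurable x)).
Qed.

Lemma measurable_insert_coordr k (i : 'I_k.+1) (eta : BT k) :
  measurable_fun [set: BR] (fun x => insert_coord i x eta : BT k.+1).
Proof.
exact: (measurableT_comp (measurable_insert_coord i) (pair2_measurable eta)).
Qed.

Lemma ge0_integral_borel_lebesgue_cons k (F : BT k.+1 -> \bar R) :
  measurable_fun setT F -> (forall t, 0 <= F t) ->
  \int[borel_lebesgue R k.+1]_t F t =
  \int[lebesgue_measure]_x \int[borel_lebesgue R k]_eta F [tuple of x :: eta].
Proof.
move=> mF F0.
rewrite (ge0_integral_preserving (phi := @tuple_cons R k)
  (m1 := lebesgue_measure \x borel_lebesgue R k))//;
  last exact: measurable_tuple_cons.
rewrite fubini_tonelli1//.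
by apply: measurableT_comp => //; exact: measurable_tuple_cons.
Qed.

(** Induction on the dimension: split off the first coordinate, bring the [i]-th one out of the
    remaining ones by induction, then exchange these two. *)
Lemma ge0_integral_borel_lebesgue_insert k (i : 'I_k.+1)
    (F : BT k.+1 -> \bar R) :
  measurable_fun setT F -> (forall t, 0 <= F t) ->
  \int[borel_lebesgue R k.+1]_t F t =
  \int[lebesgue_measure]_x \int[borel_lebesgue R k]_eta
    F (insert_coord i x eta).
Proof.
elim: k i F => [|k IH] i F mF F0;
  rewrite (ge0_integral_borel_lebesgue_cons mF F0).
  rewrite (ord1 i); apply: eq_integral => x _.
  by apply: eq_integral => eta _; rewrite insert_coord0.
have mFc : measurable_fun setT
    (fun p : BR * BT k.+1 => F [tuple of p.1 :: p.2]).
  by apply: measurableT_comp => //; exact: measurable_tuple_cons.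
have [j ->|->] := unliftP ord0 i; last first.
  apply: eq_integral => x _.
  by apply: eq_integral => eta _; rewrite insert_coord0.
under eq_integral => y _.
  rewrite (IH j); [|exact: (measurableT_comp mFc (pair1_measurable _))|by []].
  over.
(* With the other coordinates integrated out, only a double integral over the plane has to be
   exchanged. *)
pose G (p : BR * BR) := \int[borel_lebesgue R k]_eta
   F [tuple of p.1 :: insert_coord j p.2 eta].
rewrite (fubini_tonelli G).
- apply: eq_integral => x _.
  have mFx : measurable_fun setT
      (fun zeta : BT k.+1 => F (insert_coord (lift ord0 j) x zeta)).
    by apply: (measurableT_comp mF); exact: measurable_insert_coordl.
  rewrite (ge0_integral_borel_lebesgue_cons mFx (fun zeta => F0 _)).
  apply: eq_integral => y _; apply: eq_integral => eta _.
  by rewrite insert_coordS.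
- apply: (measurable_fun_fubini_tonelli_F
    (fun q : (BR * BR) * BT k =>
      F [tuple of q.1.1 :: insert_coord j q.1.2 q.2])) => //.
  apply: (measurableT_comp mF); apply: measurable_cons.
    exact: measurableT_comp.
  have mq : measurable_fun setT (fun q : (BR * BR) * BT k => (q.1.2, q.2)).
    by apply/measurable_fun_pair => //; exact: measurableT_comp.
  exact: (measurableT_comp (measurable_insert_coord j) mq).
- by move=> p; exact: integral_ge0.
Qed.

Lemma ge0_integral_borel_lebesgue_insert_swap k (i : 'I_k.+1)
    (F : BT k.+1 -> \bar R) :
  measurable_fun setT F -> (forall t, 0 <= F t) ->
  \int[borel_lebesgue R k.+1]_t F t =
  \int[borel_lebesgue R k]_eta \int[lebesgue_measure]_x
    F (insert_coord i x eta).
Proof.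
move=> mF F0; rewrite (ge0_integral_borel_lebesgue_insert i)//.
rewrite (fubini_tonelli (fun p : BR * BT k => F (insert_coord i p.1 p.2)))//.
exact: measurableT_comp (measurable_insert_coord i).
Qed.

Lemma insert_coordK k (i : 'I_k.+1) (x : R) (eta : BT k) :
  omit_coord i (insert_coord i x eta) = eta.
Proof. by apply: eq_from_tnth => j; rewrite !tnth_mktuple liftK. Qed.

Lemma tnth_insert_coord k (i : 'I_k.+1) (x : R) (eta : BT k) :
  tnth (insert_coord i x eta) i = x.
Proof. by rewrite tnth_mktuple unlift_none. Qed.

Lemma measurable_lebesgue_tuple k (A : set (BT k)) :
  measurable A -> measurable (A : set (Rn R k)).
Proof. exact: caratheodory_measurable_mu_ext. Qed.

Lemma ge0_integral_lebesgue_tuple k (F : BT k -> \bar R) :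
  measurable_fun setT F -> (forall t, 0 <= F t) ->
  \int[@lebesgue_tuple R k]_t F t = \int[borel_lebesgue R k]_t F t.
Proof.
move=> mF F0; apply/esym.
have mid : measurable_fun setT (id : Rn R k -> BT k).
  by move=> _ A mA; rewrite setTI; exact: measurable_lebesgue_tuple.
apply: (ge0_integral_preserving mid _ mF F0) => A mA.
exact: measurable_mu_extE.
Qed.

Lemma ge0_integral_completed_lebesgue (F : BR -> \bar R) :
  measurable_fun setT F -> (forall x, 0 <= F x) ->
  \int[@completed_lebesgue_measure R]_x F x = \int[lebesgue_measure]_x F x.
Proof.
move=> mF F0; apply/esym.
have mid : measurable_fun setT
    (id : caratheodory_type (wlength (@idfun R))^*%mu -> BR).
  by move=> _ A mA; rewrite setTI; exact: sub_caratheodory.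
by apply: (ge0_integral_preserving mid _ mF F0) => A mA.
Qed.

(** A null set of the completion has outer measure 0, so its measurable cover is a Borel null
    set. *)
Lemma negligible_lebesgue_tuple k (A : set (Rn R k)) :
  (@lebesgue_tuple R k).-negligible A -> (borel_lebesgue R k).-negligible A.
Proof.
move=> [M [_ M0 AM]].
have [|N [mN MN muN]] := @mu_ext_measurable_cover _ _ _ (borel_lebesgue R k) M.
  by rewrite [X in X < _]M0.
exists N; split => //; last exact: subset_trans MN.
by rewrite muN; exact: M0.
Qed.

End tuples.

(** * Almost-everywhere facts from a finite or a zero integral *)

Lemma ge0_integral_lty_ae d (T : measurableType d) (R : realType)
    (mu : {measure set T -> \bar R}) (f : T -> \bar R) :
  measurable_fun setT f -> (forall x, 0 <= f x) -> \int[mu]_x f x < +oo ->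
  \forall x \ae mu, f x < +oo.
Proof.
move=> mf f0 foo.
have intf : mu.-integrable setT f.
  by apply/integrableP; split => //; under eq_integral do rewrite gee0_abs//.
apply: filterS (integrable_ae measurableT intf) => x /(_ I).
by rewrite ge0_fin_numE.
Qed.

Lemma ge0_integral_eq0_ae d (T : measurableType d) (R : realType)
    (mu : {measure set T -> \bar R}) (f : T -> \bar R) :
  measurable_fun setT f -> (forall x, 0 <= f x) -> \int[mu]_x f x = 0 ->
  \forall x \ae mu, f x = 0.
Proof.
move=> mf f0 foo.
have /ae_eq_integral_abs : \int[mu]_x `|f x| = 0.
  by under eq_integral do rewrite gee0_abs//.
move=> /(_ measurableT mf).
by apply: filterS => x /(_ I).
Qed.

(** * The Borel core: integrability of one separable part from a single section *)

Section fixed_section.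
Variable R : realType.
Local Notation BR := (measurableTypeR R).
Local Notation BT n := (n.-tuple (measurableTypeR R)).
Variables (k : nat) (i : 'I_k.+1).
Local Notation ins := (insert_coord i).
Local Notation leb := (@lebesgue_measure R).
Local Notation mu := (borel_lebesgue R).

(* [J] and [E] are the factors of the box, [W] a Borel version of [w] extended
   by 0, [M] and [Mc] its marginals in the coordinate [i] and in the others. *)
Variables (J : set BR) (E : set (BT k)) (N : set (BT k.+1)).
Variables (W h : BT k.+1 -> R) (psi : R -> R) (g : BT k -> R) (q C : R).
Hypotheses (mJ : measurable J) (mN : measurable N) (N0 : mu k.+1 N = 0).
Hypotheses (mW : measurable_fun setT W) (W0 : forall t, (0 <= W t)%R).
Hypothesis (mh : measurable_fun setT h).
Hypothesis WJE : forall (x : BR) (eta : BT k),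
  W (ins x eta) != 0%R -> J x /\ E eta.
(** In the application [h] is n f, [psi] is Psi_i, [g] is the sum of the other terms, and [C] bounds
    w_i w_i^c / w off the null set [N]. *)
Hypothesis hE : forall (x : BR) (eta : BT k),
  J x -> E eta -> ~ N (ins x eta) ->
  h (ins x eta) = (psi x + g eta)%R.
Let M (x : BR) := \int[mu k]_eta (W (ins x eta))%:E.
Let Mc (eta : BT k) := \int[leb]_x (W (ins x eta))%:E.
Hypothesis MMc : forall (x : BR) (eta : BT k),
  J x -> E eta -> ~ N (ins x eta) ->
  M x * Mc eta <= (C * W (ins x eta))%:E.
Hypothesis W1 : \int[mu k.+1]_t (W t)%:E = 1.
Hypothesis hq : \int[mu k.+1]_t (`|h t| `^ q * W t)%:E < +oo.
Hypothesis q0 : (0 < q)%R.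

Let mWE : measurable_fun setT (fun t => (W t)%:E).
Proof. exact/measurable_EFinP. Qed.

Let mWi : measurable_fun setT (fun p : BR * BT k => (W (ins p.1 p.2))%:E).
Proof. exact: (measurableT_comp mWE (measurable_insert_coord i)). Qed.

Let mM : measurable_fun setT M.
Proof.
apply: (measurable_fun_fubini_tonelli_F (m2 := mu k)
  (fun p : BR * BT k => (W (ins p.1 p.2))%:E)) => //.
by move=> p; rewrite lee_fin.
Qed.

Let mMc : measurable_fun setT Mc.
Proof.
apply: (measurable_fun_fubini_tonelli_G (m1 := leb)
  (fun p : BR * BT k => (W (ins p.1 p.2))%:E)) => //.
by move=> p; rewrite lee_fin.
Qed.

Let M0 x : 0 <= M x.
Proof. by apply: integral_ge0 => ? _; rewrite lee_fin. Qed.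

Let Mc0 x : 0 <= Mc x.
Proof. by apply: integral_ge0 => ? _; rewrite lee_fin. Qed.

Let intM : \int[leb]_x M x = 1.
Proof. by rewrite -W1 (ge0_integral_borel_lebesgue_insert i). Qed.

Let intMc : \int[mu k]_eta Mc eta = 1.
Proof. by rewrite -W1 (ge0_integral_borel_lebesgue_insert_swap i). Qed.

Let M_nJ x : ~ J x -> M x = 0.
Proof.
move=> nJ; apply: integral0_eq => eta _.
by have [->//|/WJE[]] := eqVneq (W (ins x eta)) 0%R.
Qed.

Let Mc_nE eta : ~ E eta -> Mc eta = 0.
Proof.
move=> nE; apply: integral0_eq => x _.
by have [->//|/WJE[]] := eqVneq (W (ins x eta)) 0%R.
Qed.

Let mhq : measurable_fun setT (fun t => `|h t| `^ q)%R.
Proof.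
apply: (measurableT_comp (measurable_powR _)); exact: measurableT_comp.
Qed.

(** This is |psi + g|^q on the product [J] x [E], cut off to 0 on [N]. It is written with the Borel
    function [h] so that Tonelli applies, [psi] and [g] carrying no measurability. *)
Let H (p : BR * BT k) : \bar R :=
  (\1_(~` N) (ins p.1 p.2) * `|h (ins p.1 p.2)| `^ q)%:E.

Let H0 p : 0 <= H p. Proof. by rewrite lee_fin mulr_ge0// powR_ge0. Qed.

Let mH : measurable_fun [set: BR * BT k] H.
Proof.
have mi := @measurable_insert_coord R k i.
apply/measurable_EFinP; apply: measurable_funM.
  have mI : measurable_fun setT (\1_(~` N) : BT k.+1 -> R).
    by apply: measurable_indic; exact: measurableC.
  exact: (measurableT_comp mI mi).
exact: (measurableT_comp mhq mi).
Qed.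

Let L (p : BR * BT k) : \bar R := H p * (M p.1 * Mc p.2).

Let L0 p : 0 <= L p. Proof. by rewrite mule_ge0// mule_ge0. Qed.

Let mL : measurable_fun [set: BR * BT k] L.
Proof.
apply: emeasurable_funM => //; apply: emeasurable_funM.
  exact: (measurableT_comp mM measurable_fst).
exact: (measurableT_comp mMc measurable_snd).
Qed.

(** The bounded ratio enters here: off [N] the product of the marginals is at most C W, so the
    integral is at most |C| times that of |h|^q W. *)
Let intL : \int[mu k]_eta \int[leb]_x L (x, eta) < +oo.
Proof.
(* [C] has no prescribed sign; its absolute value keeps the majorant nonnegative. *)
apply: (@le_lt_trans _ _ (\int[mu k]_eta \int[leb]_x
    (`|C|%:E * (`|h (ins x eta)| `^ q * W (ins x eta))%:E))).
  apply: le_ge0_integral => // [eta _|eta _].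
    apply: integral_ge0 => x _.
    by rewrite mule_ge0// lee_fin mulr_ge0// powR_ge0.
  rewrite integral_ge0//=; apply: le_ge0_integral => // x _.
    by rewrite mule_ge0// lee_fin mulr_ge0// powR_ge0.
  rewrite L0/= /L /H /=.
  have [Nx|Nx] := pselect (N (ins x eta)).
    rewrite indicE memNset ?mul0r ?mul0e; last by apply.
    by rewrite mule_ge0// lee_fin mulr_ge0// powR_ge0.
  rewrite indicE mem_set// mul1r -!EFinM mulrCA EFinM.
  apply: lee_wpmul2l; first by rewrite lee_fin powR_ge0.
  (* Outside [J] x [E] one of the two marginals vanishes, and so does the left-hand side. *)
  have [Jx|/M_nJ ->] := pselect (J x); last first.
    by rewrite mul0e lee_fin mulr_ge0.
  have [Ex|/Mc_nE ->] := pselect (E eta); last first.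
    by rewrite mule0 lee_fin mulr_ge0.
  apply: (le_trans (MMc Jx Ex Nx)).
  by rewrite lee_fin ler_wpM2r// ler_norm.
rewrite -(ge0_integral_borel_lebesgue_insert_swap i
   (F := fun t => `|C|%:E * (`|h t| `^ q * W t)%:E)).
- rewrite ge0_integralZl//; first by rewrite lte_mul_pinfty.
  + apply/measurable_EFinP; apply: measurable_funM => //.
  + by move=> t _; rewrite lee_fin mulr_ge0// powR_ge0.
- apply: measurable_funeM; apply/measurable_EFinP; apply: measurable_funM => //.
- by move=> t; rewrite mule_ge0// lee_fin mulr_ge0// powR_ge0.
Qed.

(** The last two properties hold for almost every [eta]. If none of these had [Mc eta] > 0, then
    [Mc] would vanish almost everywhere, against its integral 1. *)
Let good_section : exists eta : BT k, [/\ 0 < Mc eta,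
  \int[leb]_x L (x, eta) < +oo & leb [set x | N (ins x eta)] = 0].
Proof.
have mLy : measurable_fun setT (fun eta => \int[leb]_x L (x, eta)).
  exact: (measurable_fun_fubini_tonelli_G (m1 := leb) L).
have aeL : \forall eta \ae mu k, \int[leb]_x L (x, eta) < +oo.
  by apply: ge0_integral_lty_ae => // eta; exact: integral_ge0.
have mNi : measurable_fun setT
    (fun p : BR * BT k => (\1_N (ins p.1 p.2) : R)%:E).
  apply/measurable_EFinP.
  have mI : measurable_fun setT (\1_N : BT k.+1 -> R).
    exact: measurable_indic.
  exact: (measurableT_comp mI (measurable_insert_coord i)).
(* Tonelli for the indicator of [N]: almost every section of a null set is null. *)
have aeN : \forall eta \ae mu k, \int[leb]_x (\1_N (ins x eta))%:E = 0.
  apply: ge0_integral_eq0_ae.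
  - apply: (measurable_fun_fubini_tonelli_G (m1 := leb)
      (fun p : BR * BT k => (\1_N (ins p.1 p.2))%:E)) => //.
  - by move=> eta; apply: integral_ge0 => x _; rewrite lee_fin.
  - rewrite -(ge0_integral_borel_lebesgue_insert_swap i
      (F := fun t => (\1_N t)%:E)).
    + by rewrite integral_indic// setIT.
    + by apply/measurable_EFinP; exact: measurable_indic.
    + by move=> t; rewrite lee_fin.
apply: contrapT => no_eta.
have : \int[mu k]_eta Mc eta = \int[mu k]_eta cst 0 eta.
  apply: ae_eq_integral => //.
  apply: filterS2 aeL aeN => eta Leta Neta _.
  apply: contrapT => Mc_neq0; apply: no_eta; exists eta; split => //.
    by rewrite lt_neqAle Mc0 andbT eq_sym; exact/eqP.
  have mZ : measurable [set x : BR | N (ins x eta)].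
    rewrite -[X in measurable X]setTI.
    exact: (measurable_insert_coordr i eta).
  by rewrite -(setIT [set x | _]) -(integral_indic _ _ mZ).
by rewrite intMc integral_cst// mul0e => -[] /eqP; rewrite oner_eq0.
Qed.

(** Fix [eta] from [good_section], with [Z] the section of [N]. On [J] minus [Z], [psi] is the Borel
    function h(., eta) minus the constant [g eta]. Then |psi|^q <= 2^q (|psi + g eta|^q + |g
    eta|^q), and both terms are integrable against [M]. *)
Lemma separable_part_section : exists Z, [/\ measurable Z, leb Z = 0,
  measurable_fun setT (psi \_ (J `\` Z)) &
  \int[mu k.+1]_t (`|(psi \_ (J `\` Z)) (tnth t i)| `^ q * W t)%:E < +oo].
Proof.
have [eta [Mc_gt0 Loo Z0]] := good_section.
pose Z := [set x : BR | N (ins x eta)].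
have mZ : measurable Z.
  by rewrite -[X in measurable X]setTI; exact: (measurable_insert_coordr i eta).
have mJZ : measurable (J `\` Z) by exact: measurableD.
have Eeta : E eta by apply: contrapT => /Mc_nE /eqP; rewrite gt_eqF.
have psiE : psi \_ (J `\` Z) = (fun x => h (ins x eta) - g eta)%R \_ (J `\` Z).
  apply/funext => x; rewrite !patchE; case: ifPn => // /set_mem[Jx Zx].
  by rewrite hE// addrK.
have mpsi : measurable_fun setT (psi \_ (J `\` Z)).
  rewrite psiE; apply/(measurable_restrictT _ mJZ)/measurable_funTS.
  apply: measurable_funB => //.
  exact: (measurableT_comp mh (measurable_insert_coordr i eta)).
exists Z; split; [exact: mZ|exact: Z0|exact: mpsi|].
have mpsiq : measurable_fun setT (fun x => `|(psi \_ (J `\` Z)) x| `^ q)%R.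
  by apply: (measurableT_comp (measurable_powR _)); exact: measurableT_comp.
(* Integrating out the other coordinates turns the weight [W] into [M]. *)
rewrite (ge0_integral_borel_lebesgue_insert i); last 2 first.
- apply/measurable_EFinP/measurable_funM => //.
  exact: (measurableT_comp mpsiq (measurable_tnth i)).
- by move=> t; rewrite lee_fin mulr_ge0// powR_ge0.
(* [Mc eta] may be [+oo]; division by a positive real [c] below it replaces division by [Mc eta]. *)
have [c c0 cMc] : exists2 c, (0 < c)%R & c%:E <= Mc eta.
  case: (Mc eta) Mc_gt0 => [r r0|_|//]; first by exists r.
  by exists 1%R => //; rewrite leey.
pose B x := (2 `^ q)%:E * ((c^-1)%:E * L (x, eta) + (`|g eta| `^ q)%:E * M x).
have cL0 x : 0 <= (c^-1)%:E * L (x, eta).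
  by rewrite mule_ge0// lee_fin invr_ge0 ltW.
have gM0 x : 0 <= (`|g eta| `^ q)%:E * M x.
  by rewrite mule_ge0// lee_fin powR_ge0.
have B0 x : 0 <= B x by rewrite /B mule_ge0 ?adde_ge0// lee_fin powR_ge0.
apply: (@le_lt_trans _ _ (\int[leb]_x B x)).
  apply: le_ge0_integral => // x _.
  rewrite integral_ge0/=; last first.
    by move=> ? _; rewrite lee_fin mulr_ge0// powR_ge0.
  under eq_integral do rewrite tnth_insert_coord EFinM.
  rewrite ge0_integralZl//; last 2 first.
  - exact: (measurableT_comp mWE (measurable_insert_coordl i x)).
  - by move=> ? _; rewrite lee_fin.
  (* Outside [J] minus [Z] the cut-off function is 0, and 0^q = 0 because q > 0. *)
  rewrite -/(M x) /B patchE; case: ifPn => [/set_mem[Jx Zx]|_]; last first.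
    by rewrite normr0 powR0 ?gt_eqF// mul0e; exact: B0.
  apply: (@le_trans _ _
    ((2 `^ q * (`|psi x + g eta| `^ q + `|g eta| `^ q))%:E * M x)).
    by apply: lee_wpmul2r => //; rewrite lee_fin powR_normD_le// ltW.
  rewrite EFinM -muleA; apply: lee_wpmul2l; first by rewrite lee_fin powR_ge0.
  rewrite EFinD ge0_muleDl ?lee_fin ?powR_ge0//; apply: leeD2r.
  rewrite /L /H /= indicE mem_set// mul1r hE// muleCA.
  apply: lee_wpmul2l; first by rewrite lee_fin powR_ge0.
  rewrite muleCA -[leLHS]mule1; apply: lee_wpmul2l => //.
  by rewrite lee_pdivlMl// mule1.
have mcL : measurable_fun setT (fun x => (c^-1)%:E * L (x, eta)).
  apply: measurable_funeM.
  exact: (measurableT_comp mL (pair2_measurable eta)).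
have mgM : measurable_fun setT (fun x => (`|g eta| `^ q)%:E * M x).
  exact: measurable_funeM.
rewrite /B ge0_integralZl//; last 2 first.
- exact: emeasurable_funD.
- by move=> x _; rewrite adde_ge0.
rewrite lte_mul_pinfty ?lee_fin ?powR_ge0//.
rewrite ge0_integralD//.
rewrite !ge0_integralZl//; last 2 first.
- exact: (measurableT_comp mL (pair2_measurable eta)).
- by rewrite lee_fin invr_ge0 ltW.
rewrite intM mule1 lte_add_pinfty ?ltry// lte_mul_pinfty//.
by rewrite lee_fin invr_ge0 ltW.
Qed.

End fixed_section.

(** * Boxes, marginals and null sets *)

Section box.
Variable R : realType.
Local Notation BR := (measurableTypeR R).
Local Notation BT n := (n.-tuple (measurableTypeR R)).

Lemma measurable_box k (I : 'I_k -> interval R) :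
  measurable (box I : set (BT k)).
Proof.
rewrite (_ : box I =
    \bigcap_(j in [set: 'I_k]) (fun t : BT k => tnth t j) @^-1` [set` I j]).
  apply: fin_bigcap_measurable => // j _; rewrite -[X in measurable X]setTI.
  apply: measurable_tnth => //; exact: measurable_itv.
by apply/seteqP; split => t /= It j; [move=> _; exact: It|exact: It].
Qed.

Lemma box_insert_coord k (I : 'I_k.+1 -> interval R) (i : 'I_k.+1)
    (x : R) (eta : BT k) :
  box I (insert_coord i x eta) <-> x \in I i /\ box_omit I i eta.
Proof.
split=> [Ixe|[Ix Ieta] j]; last first.
  by rewrite tnth_mktuple; case: unliftP => [l ->|->].
split; first by rewrite -(tnth_insert_coord i x eta).
by move=> l; have := Ixe (lift i l); rewrite tnth_mktuple liftK.
Qed.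

Section marginal_bounds.
Variables (k : nat) (I : 'I_k.+1 -> interval R) (i : 'I_k.+1).
Variables w W : BT k.+1 -> R.
Hypothesis mW : measurable_fun setT W.
Hypothesis Ww : forall t, (0 <= W t <= (w \_ (box I)) t)%R.

(** Only an inequality is claimed: [W] may be smaller than [w] on a null set that fills a large part
    of an exceptional section. An upper bound on the product of the marginals of [W] needs just this
    direction. *)
Lemma le_marginal (x : R) : x \in I i ->
  \int[borel_lebesgue R k]_eta (W (insert_coord i x eta))%:E <=
  marginal I w i x.
Proof.
move=> Ix; rewrite -ge0_integral_lebesgue_tuple; last 2 first.
- apply/measurable_EFinP.
  exact: (measurableT_comp mW (measurable_insert_coordl i x)).
- by move=> eta; rewrite lee_fin; case/andP: (Ww (insert_coord i x eta)).
have patch_ins (eta : BT k) :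
    ((fun eta : BT k => (w (insert_coord i x eta))%:E) \_ (box_omit I i)) eta =
    ((w \_ (box I)) (insert_coord i x eta))%:E.
  rewrite !patchE.
  have -> : (eta \in box_omit I i) = (insert_coord i x eta \in box I).
    apply/idP/idP => /set_mem H; apply/mem_set; first exact/box_insert_coord.
    by case/box_insert_coord: H.
  by case: ifPn.
rewrite /marginal [leRHS]integral_mkcond.
apply: le_ge0_integral => // eta _; rewrite patch_ins !lee_fin//.
by case/andP: (Ww (insert_coord i x eta)) => /le_trans; apply.
Qed.

Lemma le_comarginal (eta : BT k) : box_omit I i eta ->
  \int[lebesgue_measure]_x (W (insert_coord i x eta))%:E <=
  comarginal I w i eta.
Proof.
move=> Ieta; rewrite -ge0_integral_completed_lebesgue; last 2 first.
- apply/measurable_EFinP.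
  exact: (measurableT_comp mW (measurable_insert_coordr i eta)).
- by move=> x; rewrite lee_fin; case/andP: (Ww (insert_coord i x eta)).
have patch_ins (x : BR) :
    ((fun x : BR => (w (insert_coord i x eta))%:E) \_ [set` I i]) x =
    ((w \_ (box I)) (insert_coord i x eta))%:E.
  rewrite !patchE.
  have -> : (x \in [set` I i]) = (insert_coord i x eta \in box I).
    apply/idP/idP => /set_mem H; apply/mem_set; first exact/box_insert_coord.
    by case/box_insert_coord: H.
  by case: ifPn.
rewrite /comarginal [leRHS]integral_mkcond.
apply: le_ge0_integral => // x _; rewrite patch_ins !lee_fin//.
by case/andP: (Ww (insert_coord i x eta)) => /le_trans; apply.
Qed.

End marginal_bounds.

Lemma in_Loo_ae_bounded k (I : 'I_k -> interval R) (r : BT k -> \bar R) :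
  in_Loo I r -> exists C : R,
   \forall t \ae (@lebesgue_tuple R k), box I t -> r t <= C%:E.
Proof.
(* The essential supremum is only known to be below [+oo]; the maximum with 0 excludes [-oo], so
   [fine] loses nothing. *)
move=> [_]; set c := ess_sup _ _ => coo; exists (fine (maxe 0 c)).
rewrite fineK; last by rewrite ge0_fin_numE ?le_max ?lexx// gt_max coo ltry.
apply: filterS (ess_sup_ge (@lebesgue_tuple R k) (abse \o (r \_ (box I)))).
move=> t /= rt It.
rewrite le_max; apply/orP; right; apply: le_trans rt.
by rewrite patchE mem_set//; exact: lee_abs.
Qed.

Lemma measurable_fun_box_borel_null k (I : 'I_k -> interval R) (f : BT k -> R) :
  measurable_fun (box I : set (Rn R k)) (f : Rn R k -> R) ->
  exists N, [/\ measurable N, borel_lebesgue R k N = 0 &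
    measurable_fun ((box I : set (BT k)) `\` N) f].
Proof.
move=> mf.
have mf' : measurable_fun [set: Rn R k] (f \_ (box I)).
  exact/(measurable_restrictT _ (measurable_lebesgue_tuple (measurable_box I))).
have [N [mN N0 fN]] := caratheodory_measurable_fun_null mf'.
exists N; split => //.
have fND : measurable_fun ((box I : set (BT k)) `\` N) (f \_ (box I)).
  by apply: measurable_funS fN => [|t []//]; exact: measurableC.
apply: eq_measurable_fun fND.
by move=> t /set_mem[It _]; rewrite patchE mem_set.
Qed.

(** With the [i]-th coordinate outermost, the inner integrand is the constant [\1_Z x]. *)
Lemma borel_lebesgue_cylinder_null k (i : 'I_k.+1) (Z : set BR) :
  measurable Z -> lebesgue_measure Z = 0 ->
  borel_lebesgue R k.+1 ((fun t => tnth t i) @^-1` Z) = 0.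
Proof.
move=> mZ Z0.
have mA : measurable ((fun t : BT k.+1 => tnth t i) @^-1` Z).
  by rewrite -[X in measurable X]setTI; exact: measurable_tnth.
have mI : measurable_fun setT (\1_Z : BR -> R) by exact: measurable_indic.
rewrite -[X in borel_lebesgue R k.+1 X]setIT -integral_indic//.
rewrite (ge0_integral_borel_lebesgue_insert i).
- have mF : measurable_fun setT (fubini_F (borel_lebesgue R k)
      (fun p : BR * BT k => (\1_Z p.1 : R)%:E)).
    apply: measurable_fun_fubini_tonelli_F; last by move=> p; rewrite lee_fin.
    by apply/measurable_EFinP; exact: (measurableT_comp mI measurable_fst).
  under eq_integral => x _.
    under eq_integral => eta _.
      rewrite (_ : \1_ _ _ = \1_Z x); last first.
        rewrite !indicE; congr (nat_of_bool _)%:R.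
        by apply/idP/idP => /set_mem/= H; apply/mem_set; move: H;
          rewrite /= tnth_insert_coord.
      over.
    over.
  (* The inner integral may be [+oo] for [x] in [Z], so the null set [Z] is removed from the outer
     domain. *)
  rewrite (ge0_negligible_integral mZ)//; last first.
    by move=> x _; apply: integral_ge0 => ? _; rewrite lee_fin.
  apply: integral0_eq => x [_ nZ]; apply: integral0_eq => eta _.
  by rewrite indicE memNset.
- by apply/measurable_EFinP; exact: measurable_indic.
- by move=> t; rewrite lee_fin.
Qed.

Lemma ge0_integral_setD_borel_null k (D : set (BT k)) (v : BT k -> R)
    (A : set (BT k)) :
  measurable D -> measurable_fun (D : set (Rn R k)) (v : Rn R k -> R) ->
  (forall t, D t -> 0 <= v t)%R ->
  measurable A -> borel_lebesgue R k A = 0 ->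
  \int[@lebesgue_tuple R k]_(t in D) (v t)%:E =
  \int[@lebesgue_tuple R k]_(t in D `\` A) (v t)%:E.
Proof.
move=> mD mv v0 mA A0.
have mvE : measurable_fun (D : set (Rn R k)) (EFin \o v).
  exact/measurable_EFinP.
have A0' : @lebesgue_tuple R k A = 0.
  by rewrite -A0; exact: measurable_mu_extE.
exact: (ge0_negligible_integral (measurable_lebesgue_tuple mA)
  (measurable_lebesgue_tuple mD) mvE v0 A0').
Qed.

End box.

(** * Reduction to Borel functions and conclusion *)

(** [W] and [h] are [w] and n f cut off to 0 outside the box minus [N]; they are Borel, and within
    the box only a null set is affected. The bound obtained for them passes back to [w] and [Psi i]
    off a null set. *)
Lemma in_Lr_separable_part (R : realType) (k : nat) (I : 'I_k.+1 -> interval R)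
    (w : Rn R k.+1 -> R) (i : 'I_k.+1) (q : R) (f : Rn R k.+1 -> R)
    (Psi : 'I_k.+1 -> R -> R) :
  strictly_positive_density I w ->
  in_Loo I (fun xi => marginal I w i (tnth xi i) *
    comarginal I w i (omit_coord i xi) * ((w xi)^-1)%:E) ->
  (0 < q)%R ->
  ae_eq (@lebesgue_tuple R k.+1) (box I) f
    (fun xi => k.+1%:R^-1 * \sum_(j < k.+1) Psi j (tnth xi j))%R ->
  in_Lr I w q f ->
  measurable_fun (box I) (fun xi : Rn R k.+1 => Psi i (tnth xi i)) ->
  in_Lr I w q (fun xi => Psi i (tnth xi i)).
Proof.
move=> [mw w_gt0 w1] Loo q0 fPsi [mf fq] mPsi.
split; first exact: mPsi.
have [C HC] := in_Loo_ae_bounded Loo.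
have [N1 [mN1 N10 wN]] := measurable_fun_box_borel_null mw.
have [N2 [mN2 N20 fN]] := measurable_fun_box_borel_null mf.
have [N3 [mN3 N30 N3S]] := negligible_lebesgue_tuple fPsi.
have [N4 [mN4 N40 N4S]] := negligible_lebesgue_tuple HC.
(* Off [N1] and [N2], [w] and [f] are Borel on the box; off [N3], [f] is the average of the [Psi j];
   off [N4], the ratio is at most [C]. *)
pose N := N1 `|` N2 `|` (N3 `|` N4).
have mN : measurable N by apply: measurableU; exact: measurableU.
have N0 : borel_lebesgue R k.+1 N = 0.
  apply/measure_negligible => //.
  by do 2! apply: negligibleU; apply/negligibleP.
have mbx := measurable_box I.
pose D : set (k.+1.-tuple (measurableTypeR R)) := box I `\` N.
have mD : measurable D by exact: measurableD.
pose W := w \_ D.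
(* The factor n = k + 1 cancels the 1/n of the average. *)
pose h := (fun t => k.+1%:R * f t)%R \_ D.
have DN1 : D `<=` box I `\` N1 by move=> t [It /not_orP[/not_orP[]]].
have DN2 : D `<=` box I `\` N2 by move=> t [It /not_orP[/not_orP[]]].
have mW : measurable_fun setT W.
  apply/(measurable_restrictT _ mD); apply: measurable_funS DN1 wN.
  exact: measurableD.
have mh : measurable_fun setT h.
  apply/(measurable_restrictT _ mD); apply: measurable_funM => //.
  apply: measurable_funS DN2 fN; exact: measurableD.
have Ww t : (0 <= W t <= (w \_ (box I)) t)%R.
  rewrite /W !patchE; case: ifPn => [/set_mem[It _]|_].
    by rewrite mem_set// ltW ?w_gt0/=.
  by rewrite lexx/=; case: ifPn => // /set_mem /w_gt0/ltW.
have mqw (v : Rn R k.+1 -> R) : measurable_fun (box I) v ->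
    measurable_fun (box I) (fun t => `|v t| `^ q * w t)%R.
  move=> mv; apply: measurable_funM mw.
  have mn : measurable_fun (box I) (fun t => `|v t|)%R.
    exact: measurableT_comp.
  exact: (measurableT_comp (measurable_powR _) mn).
have qw0 (v : Rn R k.+1 -> R) t : box I t -> (0 <= `|v t| `^ q * w t)%R.
  by move=> It; rewrite mulr_ge0 ?powR_ge0// ltW ?w_gt0.
have W_ge0 t : (0 <= W t)%R by case/andP: (Ww t).
have [Z [mZ Z0 mpsi psi_fin]] : exists Z,
   [/\ measurable Z, lebesgue_measure Z = 0,
   measurable_fun setT (Psi i \_ ([set` I i] `\` Z)) &
   \int[borel_lebesgue R k.+1]_t
     (`|(Psi i \_ ([set` I i] `\` Z)) (tnth t i)| `^ q * W t)%:E < +oo].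
  apply: (@separable_part_section R k i [set` I i] (box_omit I i) N W h (Psi i)
    (fun eta => \sum_(j < k) Psi (lift i j) (tnth eta j))%R q C) => //.
  - move=> x eta; rewrite /W patchE; case: ifPn => [|_]; last by rewrite eqxx.
    move=> /set_mem[+ _] _.
    by move/box_insert_coord.
  - move=> x eta Ix Ieta nN.
    have Ixe : box I (insert_coord i x eta) by apply/box_insert_coord.
    rewrite /h patchE mem_set//.
    have -> : f (insert_coord i x eta) = (k.+1%:R^-1 *
       \sum_(j < k.+1) Psi j (tnth (insert_coord i x eta) j))%R.
      apply: contrapT => nE; apply: nN; right; left; apply: N3S => /= /(_ Ixe).
      exact: nE.
    rewrite mulrA mulfV ?pnatr_eq0// mul1r (bigD1_ord i)//= tnth_insert_coord.
    by congr (_ + _)%R; apply: eq_bigr => j _; rewrite tnth_mktuple liftK.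
  - move=> x eta Ix Ieta nN.
    have Ixe : box I (insert_coord i x eta) by apply/box_insert_coord.
    have : marginal I w i x * comarginal I w i eta *
        ((w (insert_coord i x eta))^-1)%:E <= C%:E.
      apply: contrapT => nE; apply: nN; right; right; apply: N4S => /= /(_ Ixe).
      by rewrite tnth_insert_coord insert_coordK.
    (* Multiply by w > 0: here [W] equals [w], while the marginals of [W] are at most those of
       [w]. *)
    rewrite lee_pdivrMr ?w_gt0// => /(le_trans _); rewrite /W patchE mem_set//.
    rewrite EFinM; apply.
    apply: lee_pmul.
    + by apply: integral_ge0 => ? _; rewrite lee_fin.
    + by apply: integral_ge0 => ? _; rewrite lee_fin.
    + exact: le_marginal.
    + exact: le_comarginal.
  - rewrite -ge0_integral_lebesgue_tuple//; last exact/measurable_EFinP.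
    rewrite -w1 (ge0_integral_setD_borel_null (v := w) (D := box I) (A := N))//;
      last by move=> t It; exact/ltW/w_gt0.
    rewrite [RHS]integral_mkcond; apply: eq_integral => t _.
    by rewrite /W !patchE; case: ifPn.
  - rewrite -ge0_integral_lebesgue_tuple; last 2 first.
    + apply/measurable_EFinP/measurable_funM => //.
      by apply: (measurableT_comp (measurable_powR _)); exact: measurableT_comp.
    + by move=> t; rewrite lee_fin mulr_ge0// powR_ge0.
    rewrite (eq_integral (fun t : Rn R k.+1 => (k.+1%:R `^ q)%:E *
       ((fun t => (`|f t| `^ q * w t)%:E) \_ D) t)); last first.
      move=> t _; rewrite /h /W !patchE.
      case: ifPn => _; last by rewrite mulr0 mule0.
      by rewrite normrM powRM// normr_nat -mulrA EFinM.
    rewrite ge0_integralZl//; last 2 first.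
    + apply/(measurable_restrictT _ (measurable_lebesgue_tuple mD)).
      apply/measurable_EFinP.
      apply: measurable_funS (mqw _ mf); first exact: measurable_lebesgue_tuple.
      by move=> t [].
    + move=> t _; rewrite patchE; case: ifPn => [/set_mem[It _]|//].
      by rewrite lee_fin qw0.
    rewrite lte_mul_pinfty ?lee_fin ?powR_ge0//.
    rewrite -integral_mkcond -(ge0_integral_setD_borel_null mbx (mqw _ mf))//.
    exact: qw0.
(* On the box off [NZ], [W] is [w] and the cut-off function is [Psi i], so the two integrands
   agree. *)
pose NZ := N `|` (fun t : k.+1.-tuple (measurableTypeR R) => tnth t i) @^-1` Z.
have mNZ : measurable NZ.
  apply: measurableU => //; rewrite -[X in measurable X]setTI.
  exact: measurable_tnth.
have NZ0 : borel_lebesgue R k.+1 NZ = 0.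
  apply/measure_negligible => //; apply: negligibleU; apply/negligibleP => //.
    by rewrite -[X in measurable X]setTI; exact: measurable_tnth.
  exact: borel_lebesgue_cylinder_null.
rewrite (ge0_integral_setD_borel_null mbx (mqw _ mPsi)
  (qw0 (fun t => Psi i (tnth t i))) mNZ NZ0).
rewrite -ge0_integral_lebesgue_tuple in psi_fin; last 2 first.
- apply/measurable_EFinP/measurable_funM => //.
  apply: (measurableT_comp (measurable_powR _)); apply: measurableT_comp => //.
  exact: (measurableT_comp mpsi (measurable_tnth i)).
- by move=> t; rewrite lee_fin mulr_ge0// powR_ge0.
apply: le_lt_trans psi_fin; apply: le_ge0_integral => //.
- by move=> t _; rewrite lee_fin mulr_ge0// powR_ge0.
- move=> t [It /not_orP[Nt Zt]].
  rewrite /W !patchE mem_set; last by split => //; exact: It.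
  by rewrite mem_set// lexx andbT lee_fin (qw0 (fun t => Psi i (tnth t i))).
Qed.

Local Close Scope ereal_scope.

Theorem proposition2p9 (R : realType) (n : nat) (I : 'I_n -> interval R)
    (w : Rn R n -> R) :
  (2 <= n)%N ->
  (forall i : 'I_n, is_closed_side (I i)) ->
  strictly_positive_density I w ->
  (forall i : 'I_n,
    in_Loo I (fun xi : Rn R n =>
      (marginal I w i (tnth xi i) * comarginal I w i (omit_coord i xi)
         * ((w xi)^-1)%:E)%E)) ->
  forall q : R, 1 < q -> smirnov_property I w q.
Proof.
case: n I w => [//|k] I w _ _ wdens Loo q q1 f Psi fPsi fq L1 i.
apply: (in_Lr_separable_part wdens (Loo i) _ fPsi fq); first exact: lt_trans q1.
by case: (L1 i).
Qed.
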